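(* Let $A$ be a positive $n \times n$ matrix with ($n$ pairwise) distinct eigenvalues. Then the algebra $\operatorname{alg}(\langle A ]) = \operatorname{lin}(\langle A ])$ is triangularizable, and so its dimension is at most $n(n+1)/2$.
   Context: A matrix is called positive if all its entries are nonnegative real numbers; $M \ge 0$ means that $M$ is positive in this sense. $[A,B] = AB - BA$. For a positive $n\times n$ matrix $A$, the super left-commutant $\langle A ]$ is the collection of all positive $n\times n$ matrices $B$ such that $[A,B] \ge 0$; it is closed under addition and multiplication. For a family $\mathcal{F}$ of complex $n\times n$ matrices, $\operatorname{lin}(\mathcal{F})$ and $\operatorname{alg}(\mathcal{F})$ denote the linear subspace and the algebra generated by $\mathcal{F}$, respectively (over $\mathbb{C}$). A family of $n\times n$ matrices is triangularizable if there is a basis of $\mathbb{C}^n$ with respect to which all members of the family have upper triangular representation. Eigenvalues are complex. *)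

(* Defs.v *)
From HB Require Import structures.
From mathcomp Require Import all_boot all_order all_algebra.
From mathcomp Require Import complex.
From mathcomp Require Import all_classical all_reals.

Set Implicit Arguments.
Unset Strict Implicit.
Unset Printing Implicit Defensive.

Import Order.TTheory GRing.Theory Num.Theory.

Local Open Scope ring_scope.
Local Open Scope classical_set_scope.

Section Defs.
Context {C : numClosedFieldType} {n : nat}.
Implicit Types (A B M X Y : 'M[C]_n) (F S : set 'M[C]_n).

(* In a numClosedFieldType, [0 <= z] already says that z is real. *)
Definition positive_mx A : Prop := forall i j, 0 <= A i j.

Definition mx_commutator A B : 'M[C]_n := A *m B - B *m A.

Definition super_left_commutant A : set 'M[C]_n :=
  [set B | positive_mx B /\ positive_mx (mx_commutator A B)].

Definition is_subspace S : Prop :=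
  S 0 /\ forall (a : C) X Y, S X -> S Y -> S (a *: X + Y).

(* A unit is not required: the families considered here contain 1%:M. *)
Definition is_subalgebra S : Prop :=
  is_subspace S /\ forall X Y, S X -> S Y -> S (X *m Y).

Definition lin F : set 'M[C]_n := smallest is_subspace F.

Definition alg F : set 'M[C]_n := smallest is_subalgebra F.

(* The columns of P are the basis; [is_trig_mx] means lower triangular,
   whence the transpose. *)
Definition triangularizable F : Prop :=
  exists2 P : 'M[C]_n, P \in unitmx &
    forall M, F M -> is_trig_mx (invmx P *m M *m P)^T.

Definition has_distinct_eigenvalues A : Prop :=
  exists s : n.-tuple C, uniq s /\ all (eigenvalue A) s.

End Defs.

(* Main.v *)
(* The super left-commutant F of A is multiplicative, and for X, Y in F both
   terms of [A, XY] = [A, X] Y + X [A, Y] are nonnegative, while the trace of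
   the sum vanishes; hence tr ([A, X] Y) = 0 on F, and by bilinearity on lin F.
   In an eigenbasis of A, the algebra lin F contains the projections onto the
   coordinate axes (polynomials in A), so it is spanned by the matrix units
   e_ij it contains. If it contained both e_ij and e_ji with i <> j, then
   0 = tr ([A, e_ij] e_ji) = l_i - l_j would contradict the distinctness of the
   eigenvalues. So the relation "e_ij is in lin F" is a partial order: sorting
   the indices along it triangularizes the algebra, and counting its pairs
   bounds the dimension. *)
Require Import Defs.
From HB Require Import structures.
From mathcomp Require Import all_boot all_order all_algebra.
From mathcomp Require Import fingroup perm complex.
From mathcomp Require Import all_classical all_reals.

Set Implicit Arguments.
Unset Strict Implicit.
Unset Printing Implicit Defensive.

Import Order.TTheory GRing.Theory Num.Theory.

Local Open Scope ring_scope.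
Local Open Scope classical_set_scope.

(** * Spans, generated algebras and diagonalization *)

Section MatrixSpaces.
Context {C : numClosedFieldType} {n : nat}.
Implicit Types (A B X Y V : 'M[C]_n) (F S : set 'M[C]_n) (d : 'rV[C]_n).

Lemma lin_subspace F : is_subspace (lin F).
Proof.
split=> [S [[S0 _] _] //|a X Y FX FY S SF].
by case: (SF) => -[_ addS] _; apply: addS; [apply: FX|apply: FY].
Qed.

Lemma lin_ind F S : is_subspace S -> F `<=` S -> lin F `<=` S.
Proof. exact: smallest_sub. Qed.

(** Two successive inductions over the span, one per argument; this carries the trace identity from
    the commutant to its span. *)
Lemma lin_bilinear0 F (f : 'M[C]_n -> 'M[C]_n -> C) :
    (forall Y, is_subspace [set X | f X Y = 0]) ->
    (forall X, is_subspace [set Y | f X Y = 0]) ->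
    (forall X Y, F X -> F Y -> f X Y = 0) ->
  forall X Y, lin F X -> lin F Y -> f X Y = 0.
Proof.
move=> fl fr f0 X Y FX; move: Y.
apply: (lin_ind (fr X)) => Y FY; move: X FX.
by apply: (lin_ind (fl Y)) => X FX; apply: f0.
Qed.

Lemma lin_subalgebra F :
  (forall X Y, F X -> F Y -> F (X *m Y)) -> is_subalgebra (lin F).
Proof.
move=> FM; split; first exact: lin_subspace.
have [F0 FD] := lin_subspace F.
move=> X Y FX; move: Y; apply: lin_ind => [|Y FY].
  split=> [|a Y Z]; rewrite /mkset; first by rewrite mulmx0.
  by rewrite mulmxDr -scalemxAr; apply: FD.
move: X FX; apply: lin_ind => [|X FX].
  split=> [|a X Z]; rewrite /mkset; first by rewrite mul0mx.
  by rewrite mulmxDl -scalemxAl; apply: FD.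
by apply: sub_gen_smallest; apply: FM.
Qed.

Lemma alg_eq_lin F :
  (forall X Y, F X -> F Y -> F (X *m Y)) -> alg F = lin F.
Proof.
move=> FM; apply/seteqP; split.
  exact: smallest_sub (lin_subalgebra FM) (@sub_gen_smallest _ _ _).
by move=> X FX S [[Ssub _] FS]; apply: FX.
Qed.

Section Subalgebra.
Variables (S : set 'M[C]_n) (Salg : is_subalgebra S).

Lemma subalgebra0 : S 0. Proof. by case: Salg => -[]. Qed.

Lemma subalgebraD X Y : S X -> S Y -> S (X + Y).
Proof. by case: Salg => -[_ SD] _ SX SY; rewrite -[X]scale1r; apply: SD. Qed.

Lemma subalgebraZ a X : S X -> S (a *: X).
Proof.
by case: Salg => -[S0 SD] _ SX; rewrite -[_ *: _]addr0; apply: SD.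
Qed.

Lemma subalgebraM X Y : S X -> S Y -> S (X *m Y).
Proof. by case: Salg => _; apply. Qed.

(** Conjugation respects products; this allows an algebra to be read in an eigenbasis. *)
Lemma subalgebra_conj V :
  V \in unitmx -> is_subalgebra [set Y | S (invmx V *m Y *m V)].
Proof.
move=> Vu; split; [split=> [|a X Y]|move=> X Y]; rewrite /mkset.
- by rewrite mulmx0 mul0mx; apply: subalgebra0.
- rewrite mulmxDr mulmxDl -scalemxAr -scalemxAl => SX SY.
  by apply: subalgebraD => //; apply: subalgebraZ.
- move=> SX SY; have := subalgebraM SX SY.
  by rewrite -!mulmxA mulKVmx.
Qed.

(** The matrix is [p] evaluated at [diag_mx d]; the induction follows Horner's scheme. *)
Lemma subalgebra_diag_poly d (p : {poly C}) :
  S 1%:M -> S (diag_mx d) -> S (diag_mx (map_mx (horner p) d)).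
Proof.
move=> S1 Sd; elim/poly_ind: p => [|p c IHp].
  rewrite (_ : diag_mx _ = 0); first exact: subalgebra0.
  by apply/matrixP=> i j; rewrite !mxE horner0 mul0rn.
rewrite (_ : diag_mx _ =
  diag_mx (map_mx (horner p) d) *m diag_mx d + c *: 1%:M).
  by apply: subalgebraD; [apply: subalgebraM|apply: subalgebraZ].
apply/matrixP=> i j; rewrite mul_diag_mx !mxE hornerMXaddC.
by case: eqP => [->|_] /=; rewrite ?mulr1n ?mulr0n ?mulr1 ?mulr0 ?addr0.
Qed.

Lemma subalgebra_diag_delta d i : injective (d 0) ->
  S 1%:M -> S (diag_mx d) -> S (delta_mx i i).
Proof.
move=> dI S1 Sd.
(* Lagrange interpolation at the diagonal entries. *)
pose p := \prod_(k | k != i) (('X - (d 0 k)%:P) * ((d 0 i - d 0 k)^-1)%:P).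
rewrite (_ : delta_mx i i = diag_mx (map_mx (horner p) d)).
  exact: subalgebra_diag_poly.
apply/matrixP=> j k; rewrite !mxE /p horner_prod.
have [->|ji] := eqVneq j i; last first.
  by rewrite (bigD1 j) //= hornerM hornerXsubC subrr mul0r mul0r mul0rn.
rewrite big1 => [|l li]; first by rewrite eq_sym.
rewrite hornerM hornerXsubC hornerC mulfV //.
by rewrite subr_eq0; apply: contraNneq li => /dI ->.
Qed.

(** Multiplying [X] by the projections e_ii on the left and e_jj on the right isolates its entry at
    (i, j). *)
Lemma subalgebra_delta d X i j : injective (d 0) ->
  S 1%:M -> S (diag_mx d) -> S X -> X i j != 0 -> S (delta_mx i j).
Proof.
move=> dI S1 Sd SX Xij.
have Se k : S (delta_mx k k) by apply: subalgebra_diag_delta Sd.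
rewrite (_ : delta_mx i j =
  (X i j)^-1 *: (delta_mx i i *m X *m delta_mx j j)).
  by apply: subalgebraZ; do 2?apply: subalgebraM.
suff -> : delta_mx i i *m X *m delta_mx j j = X i j *: delta_mx i j.
  by rewrite scalerA mulVf // scale1r.
apply/matrixP=> k l; rewrite !mxE (bigD1 j) //= big1 ?addr0 => [|m mj].
  rewrite !mxE (bigD1 i) //= big1 ?addr0 => [|m mi].
    by rewrite !mxE !eqxx andbT mulrC mulrA mulrC -natrM mulnb andbC mulrC.
  by rewrite !mxE (negPf mi) andbF mul0r.
by rewrite !mxE (negPf mj) mulr0.
Qed.

End Subalgebra.

Lemma invmx_uniq X Y : X *m Y = 1%:M -> invmx X = Y.
Proof.
move=> XY1; have [Xu _] := mulmx1_unit XY1.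
by rewrite -[RHS](mulKmx Xu) XY1 mulmx1.
Qed.

Lemma diagonalize_distinct A : has_distinct_eigenvalues A ->
  exists V d, [/\ V \in unitmx, injective (d 0) &
    A = invmx V *m diag_mx d *m V].
Proof.
case=> s [s_uniq /allP s_eig].
pose d : 'rV[C]_n := \row_i tnth s i.
have dI : injective (d 0).
  by move=> i j; rewrite !mxE => e; apply: (elimT (tuple_uniqP s)) e.
have ev i : exists v : 'rV_n, v *m A = d 0 i *: v /\ v != 0.
  have /eigenvalueP[v vA v0] := s_eig _ (mem_tnth i s).
  by exists v; rewrite mxE.
have [v vP] := choice ev.
(* The rows of [V] are left eigenvectors, as [eigenvalue] refers to row vectors. *)
pose V : 'M[C]_n := \matrix_i v i.
have VA : V *m A = diag_mx d *m V.
  by apply/row_matrixP=> i; rewrite !row_mul row_diag_mx -scalemxAl -rowE rowK;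
     case: (vP i).
have Vu : V \in unitmx.
  rewrite -row_free_unit; apply: inj_row_free => u uV.
  (* The X with X V = V Y for some Y form an algebra containing diag_mx d,
     hence the coordinate projections, so u V = 0 splits coordinatewise. *)
  pose S : set 'M[C]_n := [set X | exists Y, X *m V = V *m Y].
  have Salg : is_subalgebra S.
    split; [split=> [|a X Y [X' XE] [Y' YE]]|move=> X Y [X' XE] [Y' YE]].
    - by exists 0; rewrite mul0mx mulmx0.
    - exists (a *: X' + Y').
      by rewrite mulmxDl mulmxDr -scalemxAl -scalemxAr XE YE.
    - by exists (X' *m Y'); rewrite -mulmxA YE !mulmxA XE.
  apply/rowP=> i; rewrite mxE.
  have [||Y YE] := @subalgebra_diag_delta S Salg d i dI.
  - by exists 1%:M; rewrite mul1mx mulmx1.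
  - by exists A.
  have : u *m delta_mx i i *m V = 0 by rewrite -mulmxA YE mulmxA uV mul0mx.
  have -> : u *m delta_mx i i = u 0 i *: delta_mx 0 i.
    apply/rowP=> j; rewrite !mxE (bigD1 i) //= big1 ?addr0 => [|k ki].
      by rewrite !mxE !eqxx.
    by rewrite !mxE (negPf ki) mulr0.
  rewrite -scalemxAl -rowE rowK => /eqP; rewrite scaler_eq0.
  by case: (vP i) => _ /negPf ->; rewrite orbF => /eqP.
exists V, d; split=> //.
by rewrite -mulmxA -VA mulKmx.
Qed.

End MatrixSpaces.

(** * Algebras spanned by matrix units along a partial order *)

Section Incidence.
Context {C : numClosedFieldType} {n : nat}.
Variables (S : set 'M[C]_n) (d : 'rV[C]_n).
Hypotheses (Salg : is_subalgebra S) (dI : injective (d 0)).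
Hypotheses (S1 : S 1%:M) (Sd : S (diag_mx d)).
Hypothesis tr0 : forall X Y : 'M[C]_n, S X -> S Y ->
  \tr (mx_commutator (diag_mx d) X *m Y) = 0.

(** Membership is made boolean so that up-sets and pairs of [r] can be counted. *)
Let r : rel 'I_n := fun i j => `[< S (delta_mx i j) >].

Let r_of X i j : S X -> X i j != 0 -> r i j.
Proof. by move=> SX Xij; apply/asboolP; exact: subalgebra_delta Sd SX Xij. Qed.

Let r_refl : reflexive r.
Proof. by move=> i; apply/asboolP; exact: subalgebra_diag_delta Sd. Qed.

Let r_trans : transitive r.
Proof.
move=> j i k /asboolP Sij /asboolP Sjk; apply/asboolP.
by rewrite -(mul_delta_mx j); apply: subalgebraM.
Qed.

(** The commutator of [diag_mx d] with e_ij is (d_i - d_j) e_ij, and e_ij e_ji = e_ii has trace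
    1. *)
Let r_anti i j : r i j -> r j i -> i = j.
Proof.
move=> /asboolP Sij /asboolP Sji; apply: dI; apply/eqP; rewrite -subr_eq0.
rewrite -(tr0 Sij Sji) /mx_commutator; apply/eqP.
have -> : diag_mx d *m delta_mx i j - delta_mx i j *m diag_mx d =
          (d 0 i - d 0 j) *: delta_mx i j.
  apply/matrixP=> k l; rewrite mul_diag_mx mul_mx_diag !mxE.
  have [->|_] := eqVneq k i; have [->|_] := eqVneq l j;
    by rewrite ?mulr0 ?mul0r ?subrr // mulr1 mul1r mulr1.
rewrite -scalemxAl mul_delta_mx mxtraceZ /mxtrace (bigD1 i) //= big1.
  by rewrite mxE !eqxx addr0 mulr1.
by move=> k ki; rewrite mxE (negPf ki).
Qed.

Lemma incidence_triangularizable : triangularizable S.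
Proof.
(* Indices are sorted by decreasing size of their up-set. *)
pose f i := #|[pred j | r i j]|.
(* By transitivity the up-set of [j] lies in that of [i]; by antisymmetry it misses [i] itself. *)
have f_lt i j : r i j -> i != j -> (f j < f i)%N.
  move=> rij ij; apply: proper_card; apply/properP; split.
    by apply/fintype.subsetP=> k; exact: r_trans rij.
  exists i; first exact: r_refl.
  by apply: contra ij => /(r_anti rij) ->.
pose leT : rel 'I_n := fun i j => (f j <= f i)%N.
have sz : size (sort leT (enum 'I_n)) == n by rewrite size_sort size_enum_ord.
pose t := Tuple sz.
have tI : injective (tnth t).
  by apply/tuple_uniqP; rewrite sort_uniq enum_uniq.
have t_sorted (i j : 'I_n) : (i < j)%N -> (f (tnth t j) <= f (tnth t i))%N.
  move=> ij; rewrite !(tnth_nth i) /=.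
  have leT_tr : transitive leT by move=> x y z xy yz; apply: leq_trans yz xy.
  apply: (sorted_ltn_nth leT_tr) ij; rewrite ?inE ?(eqP sz) //.
  by apply: sort_sorted => x y; apply: leq_total.
(* With this inverse, the conjugate of [M] has entry [M (tnth t i) (tnth t j)] at (i, j). *)
exists (perm_mx (perm tI)^-1); first exact: unitmx_perm.
have -> : invmx (perm_mx (perm tI)^-1) = perm_mx (perm tI) :> 'M[C]_n.
  by apply: invmx_uniq; rewrite -perm_mxM mulVg perm_mx1.
move=> M SM; apply/is_trig_mxP => i j ij; rewrite mxE.
rewrite -row_permE -col_permE !mxE !permE.
(* A nonzero entry would relate [tnth t j] to [tnth t i] with [i < j], so [f] would increase
   strictly along the sorted list. *)
apply/eqP; apply: contraT => /(r_of SM) rji.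
have := t_sorted _ _ ij; rewrite leqNgt f_lt //.
by apply: contraTneq ij => /tI ->; rewrite ltnn.
Qed.

(** The matrix units in [S] span it, since [r] contains the support of every member; the dimension
    is at most the number of pairs in [r]. *)
Lemma incidence_vspace : exists V : {vspace 'M[C]_n},
  [set` V] = S /\ (\dim V <= (n * n.+1)./2)%N.
Proof.
pose R := [set ij : 'I_n * 'I_n | r ij.1 ij.2]%SET.
pose e : seq 'M[C]_n := [seq delta_mx ij.1 ij.2 | ij <- enum R].
have eS Y : Y \in e -> S Y.
  by case/mapP=> -[i j]; rewrite mem_enum finset.in_set => /asboolP Sij ->.
exists <<e>>%VS; split.
  apply/seteqP; split=> X /=.
    move=> XV; rewrite (coord_span (X := in_tuple e) XV).
    elim/big_ind: _ => [|Y Z|k _]; first exact: subalgebra0.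
      exact: subalgebraD.
    by apply: subalgebraZ => //; apply/eS/mem_nth.
  move=> SX; rewrite [X]matrix_sum_delta.
  apply: memv_suml => i _; apply: memv_suml => j _.
  have [->|Xij] := eqVneq (X i j) 0; first by rewrite scale0r mem0v.
  apply/memvZ/memv_span/mapP; exists (i, j) => //.
  by rewrite mem_enum finset.in_set; apply: r_of SX Xij.
apply: leq_trans (dim_span _) _; rewrite size_map -cardE.
have diagI : injective (fun i : 'I_n => (i, i)) by move=> i j [].
pose sw (ij : 'I_n * 'I_n) := (ij.2, ij.1).
have swI : injective sw by move=> [i j] [k l] [-> ->].
(* By antisymmetry R meets its transpose in the diagonal only. *)
have RI : (#|R :&: sw @: R| <= n)%N.
  rewrite -[leqRHS]card_ord -(card_imset predT diagI).
  apply/subset_leq_card/fintype.subsetP => -[i j]; rewrite finset.in_setI.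
  rewrite finset.in_set => /andP[rij /imsetP[[k l]]]; rewrite finset.in_set.
  move=> rkl [il jk]; rewrite /= -il -jk in rkl.
  by have -> : i = j := r_anti rij rkl; apply/imsetP; exists j.
(* Twice the size of [R] is the size of the union of [R] and its transpose, at most n^2, plus that
   of their intersection, at most n. *)
rewrite geq_half_double -addnn -[X in (_ + X)%N](card_imset _ swI) -cardsUI.
rewrite mulnSr leq_add // (leq_trans (max_card _)) //.
by rewrite card_prod card_ord.
Qed.

End Incidence.

(** * Products and traces in the super left-commutant *)

Section SuperLeftCommutant.
Context {C : numClosedFieldType} {n : nat}.
Variable A : 'M[C]_n.
Hypothesis A_ge0 : positive_mx A.
Let F := super_left_commutant A.

Lemma positive_mxM (X Y : 'M[C]_n) :
  positive_mx X -> positive_mx Y -> positive_mx (X *m Y).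
Proof.
by move=> X0 Y0 i j; rewrite mxE sumr_ge0 // => k _; rewrite mulr_ge0.
Qed.

Lemma mx_commutatorM (X Y : 'M[C]_n) :
  mx_commutator A (X *m Y) = mx_commutator A X *m Y + X *m mx_commutator A Y.
Proof.
by rewrite /mx_commutator mulmxBl mulmxBr !mulmxA addrA subrK.
Qed.

(** The Leibniz rule writes the commutator as a sum of products of positive matrices. *)
Lemma super_left_commutantM X Y : F X -> F Y -> F (X *m Y).
Proof.
move=> [X0 AX] [Y0 AY]; split; first exact: positive_mxM.
rewrite mx_commutatorM => i j; rewrite mxE.
by apply: addr_ge0; apply: positive_mxM.
Qed.

Lemma super_left_commutant1 : F 1%:M.
Proof.
split=> i j; first by rewrite mxE ler0n.
by rewrite /mx_commutator mulmx1 mul1mx subrr mxE.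
Qed.

Lemma super_left_commutant_self : F A.
Proof. by split=> // i j; rewrite /mx_commutator subrr mxE. Qed.

Lemma super_left_commutant_trace X Y :
  F X -> F Y -> \tr (mx_commutator A X *m Y) = 0.
Proof.
move=> [X0 AX] [Y0 AY].
have tr_ge0 (M : 'M[C]_n) : positive_mx M -> 0 <= \tr M.
  by move=> M0; apply: sumr_ge0.
have : \tr (mx_commutator A (X *m Y)) = 0.
  by rewrite /mx_commutator linearB /= mxtrace_mulC subrr.
rewrite mx_commutatorM mxtraceD => /eqP.
by rewrite paddr_eq0 ?tr_ge0 //; [case/andP => /eqP|apply: positive_mxM..].
Qed.

Lemma lin_super_left_commutant_trace X Y :
  lin F X -> lin F Y -> \tr (mx_commutator A X *m Y) = 0.
Proof.
apply: (lin_bilinear0 (f := fun X Y => \tr (mx_commutator A X *m Y))).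
- move=> Z; split=> [|a U W]; rewrite /mkset /mx_commutator.
    by rewrite mulmx0 mul0mx subrr mul0mx mxtrace0.
  move=> U0 W0; rewrite mulmxDr [(_ + W) *m A]mulmxDl -scalemxAr -scalemxAl.
  rewrite opprD addrACA -scalerBr mulmxDl -scalemxAl mxtraceD mxtraceZ.
  by rewrite U0 W0 mulr0 addr0.
- move=> Z; split=> [|a U W]; rewrite /mkset.
    by rewrite mulmx0 mxtrace0.
  by rewrite mulmxDr -scalemxAr mxtraceD mxtraceZ => -> ->; rewrite mulr0 addr0.
- exact: super_left_commutant_trace.
Qed.

End SuperLeftCommutant.

(** * Passage to the eigenbasis and back *)

Theorem corollary3p3 (R : realType) (n : nat) (A : 'M[complex R]_n)
    (A_ge0 : positive_mx A) (A_eig : has_distinct_eigenvalues A) :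
  [/\ alg (super_left_commutant A) = lin (super_left_commutant A),
      triangularizable (alg (super_left_commutant A)) &
      exists V : {vspace 'M[complex R]_n},
        [set` V] = alg (super_left_commutant A) /\
        (\dim V <= (n * n.+1)./2)%N].
Proof.
set F := super_left_commutant A.
have FM : forall X Y, F X -> F Y -> F (X *m Y) by exact: super_left_commutantM.
have algE := alg_eq_lin FM; have Salg := lin_subalgebra FM.
have [V [d [Vu dI AE]]] := diagonalize_distinct A_eig.
(* [T] is [lin F] in eigenbasis coordinates, where [A] becomes [diag_mx d]. *)
pose T := [set Y | lin F (invmx V *m Y *m V)].
have Talg : is_subalgebra T by apply: subalgebra_conj.
have T1 : T 1%:M.
  rewrite /T /mkset mulmx1 mulVmx //.
  by apply: sub_gen_smallest; apply: super_left_commutant1.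
have Td : T (diag_mx d).
  rewrite /T /mkset -AE.
  by apply: sub_gen_smallest; apply: super_left_commutant_self.
have Ttr X Y : T X -> T Y -> \tr (mx_commutator (diag_mx d) X *m Y) = 0.
  move=> TX TY; rewrite -(lin_super_left_commutant_trace TX TY) AE.
  (* The trace is invariant under the conjugation that takes [diag_mx d] to [A]. *)
  transitivity (\tr (invmx V *m (mx_commutator (diag_mx d) X *m Y) *m V)).
    by rewrite [RHS]mxtrace_mulC !mulmxA mulmxV // mul1mx.
  congr (\tr _); rewrite /mx_commutator.
  by rewrite !(mulmxBr, mulmxBl) !mulmxA !mulmxK.
split=> //; rewrite algE.
- have [P Pu PT] := incidence_triangularizable Talg dI T1 Td Ttr.
  exists (invmx V *m P); first by rewrite unitmx_mul unitmx_inv Vu.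
  move=> M FM'; have -> : invmx (invmx V *m P) = invmx P *m V.
    by apply: invmx_uniq; rewrite mulmxA mulmxK // mulVmx.
  have := PT (V *m M *m invmx V).
  by rewrite /T /mkset !mulmxA mulVmx // mul1mx mulmxKV //; apply.
- have [W [WE dW]] := incidence_vspace Talg dI T1 Td Ttr.
  (* [g] undoes the change of coordinates, mapping [T] onto [lin F]; a linear image has no larger
     dimension. *)
  pose g := linfun (mulmxr V \o mulmx (invmx V)) : 'End('M[complex R]_n).
  exists (g @: W)%VS; split.
    apply/seteqP; split=> X /=.
      case/memv_imgP=> Y YW ->; rewrite lfunE /=.
      by have : [set` W] Y by []; rewrite WE.
    move=> FX; apply/memv_imgP; exists (V *m X *m invmx V).
      suff : [set` W] (V *m X *m invmx V) by [].
      by rewrite WE /T /mkset !mulmxA mulVmx // mul1mx mulmxKV.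
    by rewrite lfunE /= !mulmxA mulVmx // mul1mx mulmxKV.
  by apply: leq_trans dW; rewrite -(limg_ker_dim g W) leq_addl.
Qed.
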